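(* Let $L\in\mathbb{N}$ and let $\langle u_n\rangle_{n=1}^{\infty}$ be a periodic sequence of real numbers with period $L$. Then there exists a continuous periodic function $f:[1,\infty)\to\mathbb{R}$ with the same period $L$ such that $f(n)=u_n$ for all $n\in\mathbb{N}$.
   Context: $\mathbb{N}=\{1,2,3,\dots\}$. A sequence $\langle u_n\rangle_{n=1}^{\infty}$ is periodic with period $L$ if $u_{i+kL}=u_i$ for all $i\in\mathbb{N}$ and $k\in\mathbb{Z}$ with $i+kL\in\mathbb{N}$. A function $f:[1,\infty)\to\mathbb{R}$ is periodic with period $L$ if $f(x+kL)=f(x)$ for all $x\in[1,\infty)$ and $k\in\mathbb{Z}$ with $x+kL\in[1,\infty)$. Periods are not required to be minimal. *)

(* Defs.v *)
From HB Require Import structures.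
From mathcomp Require Import all_boot all_order all_algebra.
From mathcomp Require Import all_classical all_reals all_analysis.
Set Implicit Arguments.
Unset Strict Implicit.
Unset Printing Implicit Defensive.
Import Order.TTheory GRing.Theory Num.Theory.
Import numFieldNormedType.Exports.
Local Open Scope classical_set_scope.
Local Open Scope ring_scope.

(* A sequence indexed by {1, 2, 3, ...} is a total [u : nat -> T] whose value
   at 0 is irrelevant. The index i + k L is computed in [int]; [absz] only
   casts it back to [nat], since it is required to be positive. *)
Definition periodic_seq (T : Type) (L : nat) (u : nat -> T) : Prop :=
  forall (i : nat) (k : int), (0 < i)%N -> 0 < i%:Z + k * L%:Z ->
    u (absz (i%:Z + k * L%:Z)) = u i.

(* A function on [1, +oo) is a total [f : R -> R] whose values below 1 are
   irrelevant. *)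
Definition periodic_fun (R : realType) (L : nat) (f : R -> R) : Prop :=
  forall (x : R) (k : int), 1 <= x -> 1 <= x + k%:~R * L%:R ->
    f (x + k%:~R * L%:R) = f x.

(* Main.v *)
Require Import Defs.
From HB Require Import structures.
From mathcomp Require Import all_boot all_order all_algebra.
From mathcomp Require Import all_classical all_reals all_analysis.
From mathcomp Require Import zify.
Set Implicit Arguments.
Unset Strict Implicit.
Unset Printing Implicit Defensive.
Import Order.TTheory GRing.Theory Num.Theory.
Import numFieldNormedType.Exports.
Local Open Scope classical_set_scope.
Local Open Scope ring_scope.

(** Trigonometric Lagrange interpolation: the squared sine has period [pi], so
    [trig_node i], a product of squared sines of [pi (x - j) / L] over the
    residues [j <> i], normalised at [i], is continuous of period [L], takes
    the value 1 at [i] and vanishes at the other residues modulo [L]. *)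

(** For negative [k], the natural-multiple case applies at the translated point, from which adding
    the multiple of [T] leads back to [x]. *)
Lemma periodicz (U V : zmodType) (f : U -> V) (T : U) (k : int) (x : U) :
  periodic f T -> f (x + T *~ k) = f x.
Proof.
move=> fT; case: k => n; first by rewrite -pmulrn periodicn.
by rewrite NegzE mulrNz -pmulrn -(periodicn fT n.+1 (x - _)) subrK.
Qed.

Definition trig_node (R : realType) (L : nat) (i : 'I_L) (x : R) : R :=
  \prod_(j < L | j != i) (sin (pi * (x - j%:R) / L%:R) /
                          sin (pi * (i%:R - j%:R) / L%:R)) ^+ 2.

(** Distinct residues differ by less than [L], so the angle is nonzero and strictly between [-pi]
    and [pi]; oddness of sine reduces to the positive case. This makes the normalisation in
    [trig_node] legitimate. *)
Lemma sin_node_neq0 (R : realType) (L : nat) (i j : 'I_L) :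
  j != i -> sin (pi * (i%:R - j%:R) / L%:R : R) != 0.
Proof.
have L_gt0 : (0 < L)%N := leq_ltn_trans (leq0n i) (ltn_ord i).
have sin_gt0 (k l : 'I_L) : (k < l)%N -> 0 < sin (pi * (l%:R - k%:R) / L%:R : R).
  move=> kl; apply: sin_gt0_pi.
  rewrite -natrB ?(ltnW kl)// divr_gt0 ?mulr_gt0 ?pi_gt0 ?ltr0n ?subn_gt0//=.
  rewrite ltr_pdivrMr ?ltr0n// ltr_pM2l ?pi_gt0// ltr_nat.
  exact: leq_ltn_trans (leq_subr _ _) (ltn_ord l).
rewrite neq_ltn => /orP[] /sin_gt0; first by move/lt0r_neq0.
by rewrite -opprB mulrN mulNr sinN oppr_gt0 => /ltr0_neq0.
Qed.

Lemma trig_nodeE (R : realType) (L : nat) (i k : 'I_L) :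
  trig_node i k%:R = (k == i)%:R :> R.
Proof.
rewrite /trig_node; have [->|ki] := eqVneq k i.
  by rewrite big1// => j ji; rewrite divff ?expr1n// sin_node_neq0.
(* The factor of index [k] has numerator [sin 0]. *)
by rewrite (bigD1 k)//= subrr mulr0 mul0r sin0 mul0r expr0n mul0r.
Qed.

(** Translation by [L] adds [pi] to each angle and flips all [L - 1] sines; without the squares, the
    product would change sign for even [L]. *)
Lemma trig_node_periodic (R : realType) (L : nat) (i : 'I_L) :
  periodic (@trig_node R L i) L%:R.
Proof.
have L_gt0 : (0 < L)%N := leq_ltn_trans (leq0n i) (ltn_ord i).
move=> x; apply: eq_bigr => j _.
rewrite addrAC mulrDr mulrDl mulfK ?pnatr_eq0 -?lt0n//.
by rewrite sinDpi mulNr sqrrN.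
Qed.

Lemma trig_node_continuous (R : realType) (L : nat) (i : 'I_L) :
  continuous (@trig_node R L i).
Proof.
apply: continuous_big => [|j _ x]; first exact: mul_continuous.
have argC : continuous (fun y : R => pi * (y - j%:R) / L%:R).
  move=> y; apply: cvgM; last exact: cvg_cst.
  apply: cvgM; first exact: cvg_cst.
  by apply: cvgB; [exact: cvg_id | exact: cvg_cst].
have sinC := continuous_comp (argC x) (@continuous_sin R _).
have quotC := continuousM sinC
  (@cst_continuous _ _ (sin (pi * (i%:R - j%:R) / L%:R))^-1 x).
(* The square is convertible to the product of the quotient with itself. *)
exact: (continuousM quotC quotC).
Qed.

Lemma trig_interpolation (R : realType) (L : nat) (v : 'I_L -> R) :
  exists f : R -> R, [/\ continuous f, periodic f L%:R
                       & forall k : 'I_L, f k%:R = v k].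
Proof.
exists (fun x => \sum_(i < L) v i * trig_node i x); split.
- apply: continuous_big => [|i _ x]; first exact: add_continuous.
  apply: cvgM; first exact: cvg_cst.
  exact: trig_node_continuous.
- by move=> x; apply: eq_bigr => i _; rewrite trig_node_periodic.
- move=> k; rewrite (bigD1 k)//= big1 ?addr0 => [|i ik].
    by rewrite trig_nodeE eqxx mulr1.
  by rewrite trig_nodeE eq_sym (negPf ik) mulr0.
Qed.

Theorem proposition4p2 (R : realType) (L : nat) (u : nat -> R)
    (hL : (0 < L)%N) (hu : periodic_seq L u) :
  exists f : R -> R,
    [/\ {within `[1, +oo[, continuous f},
        periodic_fun L f
      & forall n : nat, (0 < n)%N -> f n%:R = u n].
Proof.
(* The samples are shifted by [L] because [u 0] is a junk value. *)
have [f [fC fL fu]] := trig_interpolation (fun i : 'I_L => u (i + L)%N).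
exists f; split.
- exact: continuous_subspaceT.
- by move=> x k _ _; rewrite mulrzl periodicz.
- move=> n n_gt0.
  have nmod : (n %% L < L)%N by rewrite ltn_mod.
  rewrite {1}(divn_eq n L) addnC natrD natrM mulr_natl periodicn//.
  rewrite (fu (Ordinal nmod))/=.
  (* Shifting [n] by [1 - n %/ L] periods, rather than [- (n %/ L)], lands on the sampled index
     [n %% L + L], which is positive even when [L] divides [n]. *)
  have shiftE : n%:Z + (1 - (n %/ L)%:Z) * L%:Z = (n %% L + L)%N :> int.
    by rewrite {1}(divn_eq n L); lia.
  have := hu n (1 - (n %/ L)%:Z) n_gt0.
  by rewrite shiftE /=; apply; rewrite ltz_nat addn_gt0 hL orbT.
Qed.
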